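(* Let $\theta\in(0,1)$. The Neumann-Dirichlet algorithm ND$_2$ converges if and only if $$\rho_{\mathrm{ND}_2}:=\max_{1\le i\le n}\Big|1-\theta\Big(1+\tanh(a_i)\frac{\sigma_i\tanh(b_i)+\omega_i}{\sigma_i+\omega_i\tanh(b_i)}\Big)\Big|<1.$$
   Context: Let $A\in\mathbb{R}^{n\times n}$ be symmetric with eigenvalues $d_1,\dots,d_n$, and let $\nu>0$, $\gamma\ge 0$, $T>0$, $0<\alpha<T$. Set $\Omega_1=(0,\alpha)$, $\Omega_2=(\alpha,T)$, $\sigma_i=\sqrt{d_i^2+\nu^{-1}}$, $\omega_i=\nu^{-1}\gamma+d_i$, $a_i=\sigma_i\alpha$, $b_i=\sigma_i(T-\alpha)$. Algorithm ND$_2$ (error equations): for each $i$, given an initial guess $f_i^0\in\mathbb{R}$, for $k=1,2,\dots$: (1) solve $\dot z_{1,i}^k+d_iz_{1,i}^k-\nu^{-1}\mu_{1,i}^k=0$, $\dot\mu_{1,i}^k-z_{1,i}^k-d_i\mu_{1,i}^k=0$ in $\Omega_1$ with $z_{1,i}^k(0)=0$, $\dot z_{1,i}^k(\alpha)=f_i^{k-1}$; (2) solve $\dot z_{2,i}^k+d_iz_{2,i}^k-\nu^{-1}\mu_{2,i}^k=0$, $\dot\mu_{2,i}^k-z_{2,i}^k-d_i\mu_{2,i}^k=0$ in $\Omega_2$ with $z_{2,i}^k(\alpha)=z_{1,i}^k(\alpha)$, $\mu_{2,i}^k(T)+\gamma z_{2,i}^k(T)=0$; (3) set $f_i^k=(1-\theta)f_i^{k-1}+\theta\dot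 z_{2,i}^k(\alpha)$. The algorithm converges if $f_i^k\to 0$ as $k\to\infty$ for every $i$ and every initial guess $(f_1^0,\dots,f_n^0)\in\mathbb{R}^n$. *)

(* Defs.v *)
From HB Require Import structures.
From mathcomp Require Import all_boot all_order all_algebra.
From mathcomp Require Import all_classical all_reals all_analysis.

Set Implicit Arguments.
Unset Strict Implicit.
Unset Printing Implicit Defensive.

Import Order.TTheory GRing.Theory Num.Theory.
Import numFieldNormedType.Exports.
Local Open Scope classical_set_scope.
Local Open Scope ring_scope.

Definition sinh (R : realType) (x : R) : R := (expR x - expR (- x)) / 2.
Definition cosh (R : realType) (x : R) : R := (expR x + expR (- x)) / 2.
Definition tanh (R : realType) (x : R) : R := sinh x / cosh x.

Definition is_left_derive (R : realType) (z : R -> R) (x l : R) : Prop :=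
  h^-1 * (z (x + h) - z x) @[h --> (0 : R)^'-] --> l.

Definition is_right_derive (R : realType) (z : R -> R) (x l : R) : Prop :=
  h^-1 * (z (x + h) - z x) @[h --> (0 : R)^'+] --> l.

(* Classical solutions on the open interval, continuous up to its end points.
   The values of z and mu outside [lo, hi] are irrelevant, so derivatives at an
   end point must be taken one-sided, from inside the interval. *)
Definition solves_system (R : realType) (nu d lo hi : R) (z mu : R -> R) : Prop :=
  [/\ {within `[lo, hi], continuous z},
      {within `[lo, hi], continuous mu} &
      forall t, t \in `]lo, hi[ ->
        [/\ derivable z t 1, derivable mu t 1,
            derive1 z t + d * z t - nu^-1 * mu t = 0 &
            derive1 mu t - z t - d * mu t = 0]].

Definition nd2_subproblem1 (R : realType) (nu alpha d f : R) (z mu : R -> R)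
  : Prop :=
  [/\ solves_system nu d 0 alpha z mu, z 0 = 0 & is_left_derive z alpha f].

Definition nd2_subproblem2 (R : realType) (nu gamma T alpha d zalpha : R)
    (z mu : R -> R) : Prop :=
  [/\ solves_system nu d alpha T z mu, z alpha = zalpha &
      mu T + gamma * z T = 0].

(* One iteration for the eigenvalue d, with f = f^{k-1} and f' = f^k. *)
Definition nd2_step (R : realType) (nu gamma T alpha theta d f f' : R) : Prop :=
  exists z1 mu1 z2 mu2 : R -> R, exists dz2 : R,
    [/\ nd2_subproblem1 nu alpha d f z1 mu1,
        nd2_subproblem2 nu gamma T alpha d (z1 alpha) z2 mu2,
        is_right_derive z2 alpha dz2 &
        f' = (1 - theta) * f + theta * dz2].

Definition nd2_iterates (R : realType) (nu gamma T alpha theta : R) (n : nat)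
    (d : 'I_n -> R) (f0 : 'I_n -> R) (f : nat -> 'I_n -> R) : Prop :=
  (forall i, f 0%N i = f0 i) /\
  (forall k i, nd2_step nu gamma T alpha theta (d i) (f k i) (f k.+1 i)).

Definition nd2_converges (R : realType) (nu gamma T alpha theta : R) (n : nat)
    (d : 'I_n -> R) : Prop :=
  forall (f0 : 'I_n -> R) (f : nat -> 'I_n -> R),
    nd2_iterates nu gamma T alpha theta d f0 f ->
    forall i, f k i @[k --> \oo] --> (0 : R).

Definition nd2_sigma (R : realType) (nu d : R) : R := Num.sqrt (d ^+ 2 + nu^-1).

Definition nd2_omega (R : realType) (nu gamma d : R) : R := nu^-1 * gamma + d.

Definition nd2_factor (R : realType) (nu gamma T alpha theta d : R) : R :=
  let sigma := nd2_sigma nu d in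
  let omega := nd2_omega nu gamma d in
  let a := sigma * alpha in
  let b := sigma * (T - alpha) in
  1 - theta * (1 + tanh a * ((sigma * tanh b + omega) /
                             (sigma + omega * tanh b))).

(* The default value 0 of the maximum is harmless: all terms are nonnegative. *)
Definition rho_nd2 (R : realType) (nu gamma T alpha theta : R) (n : nat)
    (d : 'I_n -> R) : R :=
  \big[Num.max/0]_(i < n) `|nd2_factor nu gamma T alpha theta (d i)|.

(* Main.v *)
(* The system gives z'' = sigma^2 z, so a solution is determined by its values of
   (z, mu) at alpha.  Eliminating the subproblems, the Dirichlet value passed to
   step (2) is f tanh(a) / sigma, and the Neumann value it returns is that value
   times - sigma (sigma tanh b + omega) / (sigma + omega tanh b).  One iteration
   is therefore the multiplication of f by the scalar inside the absolute value
   of rho, and its powers tend to 0 iff it has modulus less than 1.  The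
   denominators do not vanish because omega >= d > - sigma. *)
Require Import Defs.
From mathcomp Require Import all_boot all_order all_algebra.
From mathcomp Require Import all_classical all_reals all_analysis.
From mathcomp Require Import ring lra.
Import Order.TTheory GRing.Theory Num.Theory.
Import numFieldNormedType.Exports.
Local Open Scope ring_scope.
Set Implicit Arguments.
Unset Strict Implicit.

(** * Hyperbolic functions *)

Lemma cosh_gt0 (R : realType) (x : R) : 0 < cosh x.
Proof. by rewrite divr_gt0// addr_gt0 ?expR_gt0. Qed.

Lemma sinh_ge0 (R : realType) (x : R) : 0 <= x -> 0 <= sinh x.
Proof. by move=> x0; rewrite divr_ge0// subr_ge0 ler_expR; lra. Qed.

Lemma sinh_lt_cosh (R : realType) (x : R) : sinh x < cosh x.
Proof. by rewrite /sinh /cosh; have := expR_gt0 (- x); lra. Qed.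

Lemma sinhN (R : realType) (x : R) : sinh (- x) = - sinh x.
Proof. by rewrite /sinh opprK; field. Qed.

Lemma coshN (R : realType) (x : R) : cosh (- x) = cosh x.
Proof. by rewrite /cosh opprK addrC. Qed.

(** Both signs of the rate [s] occur later: in the two exponentials of [sinh] and [cosh], and in an
    integrating factor. *)
Lemma is_derive_expR_affine (R : realType) (s t0 t : R) :
  is_derive t 1 (fun t => expR (s * (t - t0))) (s * expR (s * (t - t0))).
Proof.
have h : is_derive t 1 (fun t => s * (t - t0)) s.
  by apply: is_derive_eq; rewrite !(scaler0, oppr0, addr0) /GRing.scale /= mulr1.
have := @is_derive1_comp _ expR (fun t => s * (t - t0)) t _ _
  (is_derive_expR _) h.
by move=> /is_derive_eq; apply; rewrite mulrC.
Qed.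

Lemma is_derive_sinh_affine (R : realType) (s t0 t : R) :
  is_derive t 1 (fun t => sinh (s * (t - t0))) (s * cosh (s * (t - t0))).
Proof.
have h1 := is_derive_expR_affine s t0 t.
have h2 := is_derive_expR_affine (- s) t0 t.
have -> : (fun t => sinh (s * (t - t0))) =
    (fun t => 2^-1 * (expR (s * (t - t0)) - expR (- s * (t - t0)))).
  by apply/funext => u; rewrite /sinh mulNr mulrC.
apply: is_derive_eq; rewrite /GRing.scale /= /cosh -[- (s * _)]mulNr.
by ring.
Qed.

Lemma is_derive_cosh_affine (R : realType) (s t0 t : R) :
  is_derive t 1 (fun t => cosh (s * (t - t0))) (s * sinh (s * (t - t0))).
Proof.
have h1 := is_derive_expR_affine s t0 t.
have h2 := is_derive_expR_affine (- s) t0 t.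
have -> : (fun t => cosh (s * (t - t0))) =
    (fun t => 2^-1 * (expR (s * (t - t0)) + expR (- s * (t - t0)))).
  by apply/funext => u; rewrite /cosh mulNr mulrC.
apply: is_derive_eq; rewrite /GRing.scale /= /sinh -[- (s * _)]mulNr.
by ring.
Qed.

(** * Explicit solutions of the system and their uniqueness *)

Lemma nd2_sigma_gt0 (R : realType) (nu d : R) : 0 < nu -> 0 < nd2_sigma nu d.
Proof. by move=> nu0; rewrite sqrtr_gt0 ltr_wpDl ?sqr_ge0 ?invr_gt0. Qed.

Lemma nd2_sigma_sqr (R : realType) (nu d : R) :
  0 < nu -> nd2_sigma nu d ^+ 2 = d ^+ 2 + nu^-1.
Proof. by move=> nu0; rewrite sqr_sqrtr// addr_ge0 ?sqr_ge0 ?invr_ge0 ?ltW. Qed.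

Lemma normr_lt_nd2_sigma (R : realType) (nu d : R) :
  0 < nu -> `|d| < nd2_sigma nu d.
Proof.
move=> nu0; rewrite -sqrtr_sqr ltr_sqrt; first by rewrite ltrDl invr_gt0.
by rewrite ltr_wpDl ?sqr_ge0 ?invr_gt0.
Qed.

(* The matrix [M = [[-d, nu^-1], [1, d]]] of the system satisfies
   [M^2 = sigma^2 I], so [exp (tM) = cosh (sigma t) I + sinh (sigma t) / sigma M]. *)
Definition flow_z (R : realType) (nu d z0 m0 t : R) : R :=
  z0 * cosh (nd2_sigma nu d * t) +
  (nu^-1 * m0 - d * z0) / nd2_sigma nu d * sinh (nd2_sigma nu d * t).

Definition flow_mu (R : realType) (nu d z0 m0 t : R) : R :=
  m0 * cosh (nd2_sigma nu d * t) +
  (z0 + d * m0) / nd2_sigma nu d * sinh (nd2_sigma nu d * t).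

Lemma flow_z0 (R : realType) (nu d z0 m0 : R) : flow_z nu d z0 m0 0 = z0.
Proof.
by rewrite /flow_z mulr0 /sinh /cosh oppr0 subrr mul0r mulr0 addr0 expR0; field.
Qed.

Lemma flow_mu0 (R : realType) (nu d z0 m0 : R) : flow_mu nu d z0 m0 0 = m0.
Proof.
by rewrite /flow_mu mulr0 /sinh /cosh oppr0 subrr mul0r mulr0 addr0 expR0; field.
Qed.

Lemma is_derive_flow_z (R : realType) (nu d z0 m0 t0 t : R) : 0 < nu ->
  is_derive t 1 (fun t => flow_z nu d z0 m0 (t - t0))
    (nu^-1 * flow_mu nu d z0 m0 (t - t0) - d * flow_z nu d z0 m0 (t - t0)).
Proof.
move=> nu0; have s0 := nd2_sigma_gt0 d nu0; have ssq := nd2_sigma_sqr d nu0.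
rewrite /flow_z /flow_mu; set s := nd2_sigma nu d in s0 ssq *.
have hs := is_derive_sinh_affine s t0 t.
have hc := is_derive_cosh_affine s t0 t.
apply: is_derive_eq; rewrite /GRing.scale /=.
(* Eliminating [nu^-1] leaves an identity of rational functions with [s] as only denominator. *)
have -> : nu^-1 = s ^+ 2 - d ^+ 2 by lra.
by field; rewrite gt_eqF.
Qed.

Lemma is_derive_flow_mu (R : realType) (nu d z0 m0 t0 t : R) : 0 < nu ->
  is_derive t 1 (fun t => flow_mu nu d z0 m0 (t - t0))
    (flow_z nu d z0 m0 (t - t0) + d * flow_mu nu d z0 m0 (t - t0)).
Proof.
move=> nu0; have s0 := nd2_sigma_gt0 d nu0; have ssq := nd2_sigma_sqr d nu0.
rewrite /flow_z /flow_mu; set s := nd2_sigma nu d in s0 ssq *.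
have hs := is_derive_sinh_affine s t0 t.
have hc := is_derive_cosh_affine s t0 t.
apply: is_derive_eq; rewrite /GRing.scale /=.
have -> : nu^-1 = s ^+ 2 - d ^+ 2 by lra.
by field; rewrite gt_eqF.
Qed.

Lemma flow_solves_system (R : realType) (nu d lo hi z0 m0 t0 : R) : 0 < nu ->
  solves_system nu d lo hi (fun t => flow_z nu d z0 m0 (t - t0))
                           (fun t => flow_mu nu d z0 m0 (t - t0)).
Proof.
move=> nu0; split.
- by apply: derivable_within_continuous => t _;
    have := is_derive_flow_z d z0 m0 t0 t nu0.
- by apply: derivable_within_continuous => t _;
    have := is_derive_flow_mu d z0 m0 t0 t nu0.
- move=> t _; have hz := is_derive_flow_z d z0 m0 t0 t nu0.
  have hm := is_derive_flow_mu d z0 m0 t0 t nu0.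
  by split; rewrite ?derive1E ?derive_val//; ring.
Qed.

(* [(1, s + d)] with [s = sigma] or [s = - sigma] is a left eigenvector of the
   matrix of the system. *)
Lemma solves_system_first_integral (R : realType) (nu d lo hi s t0 t : R)
    (z mu : R -> R) :
  s ^+ 2 = d ^+ 2 + nu^-1 -> solves_system nu d lo hi z mu ->
  t0 \in `[lo, hi] -> t \in `[lo, hi] ->
  z t + (s + d) * mu t = expR (s * (t - t0)) * (z t0 + (s + d) * mu t0).
Proof.
move=> ssq [cz cm ode] t0lh tlh.
(* By the eigenvector property [z + (s + d) * mu] grows at rate [s], so the integrating factor makes
   [F] constant. *)
pose F := fun u => expR (- s * (u - t0)) * (z u + (s + d) * mu u).
have Fcst u : u \in `[lo, hi] -> F u = F lo.
  move=> ulh.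
  have lou : lo <= u by move: ulh; rewrite in_itv/= => /andP[].
  have uhi : u <= hi by move: ulh; rewrite in_itv/= => /andP[].
  have sub : (`[lo, u] `<=` `[lo, hi])%classic.
    by apply: subset_itvl; rewrite bnd_simp.
  (* The equations hold only in the open interval; continuity of [F] carries constancy to the end
     points. *)
  have := @MVT_segment R F (fun=> 0) lo u lou.
  case.
  - move=> x xlu.
    have /ode[dz dm ez em] : x \in `]lo, hi[.
      by move: xlu; rewrite !in_itv/= => /andP[-> /lt_le_trans]; apply.
    have hz : is_derive x 1 z (nu^-1 * mu x - d * z x).
      by apply: DeriveDef => //; rewrite -derive1E; lra.
    have hm : is_derive x 1 mu (z x + d * mu x).
      by apply: DeriveDef => //; rewrite -derive1E; lra.
    have he := is_derive_expR_affine (- s) t0 x.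
    apply: is_derive_eq; rewrite /GRing.scale /=.
    have -> : nu^-1 = s ^+ 2 - d ^+ 2 by rewrite ssq; ring.
    by ring.
  - have cE : ({within `[lo, u], continuous (fun u => expR (- s * (u - t0)))})%classic.
      by apply: derivable_within_continuous => x _;
        have := is_derive_expR_affine (- s) t0 x.
    move=> x; apply: cvgM; first exact: cE.
    apply: cvgD; first exact: (continuous_subspaceW sub cz).
    by apply: cvgM; [exact: cvg_cst|exact: (continuous_subspaceW sub cm)].
  - by move=> c _ /eqP; rewrite mul0r subr_eq0 => /eqP.
have : F t = F t0 by rewrite !Fcst.
rewrite /F subrr mulr0 expR0 mul1r => <-.
by rewrite mulrA -expRD mulNr subrr expR0 mul1r.
Qed.

(** The first integrals for [sigma] and [- sigma] are two linear equations for [z t] and [mu t],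
    with determinant [- 2 * sigma], which is nonzero. *)
Lemma solves_system_flow (R : realType) (nu d lo hi t0 t : R) (z mu : R -> R) :
  0 < nu -> solves_system nu d lo hi z mu ->
  t0 \in `[lo, hi] -> t \in `[lo, hi] ->
  z t = flow_z nu d (z t0) (mu t0) (t - t0) /\
  mu t = flow_mu nu d (z t0) (mu t0) (t - t0).
Proof.
move=> nu0 sol t0lh tlh.
have s0 := nd2_sigma_gt0 d nu0; have ssq := nd2_sigma_sqr d nu0.
rewrite /flow_z /flow_mu; set s := nd2_sigma nu d in s0 ssq *.
have nsq : (- s) ^+ 2 = d ^+ 2 + nu^-1 by rewrite sqrrN.
have ep := solves_system_first_integral ssq sol t0lh tlh.
have em := solves_system_first_integral nsq sol t0lh tlh.
rewrite /sinh /cosh -[- (s * _)]mulNr.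
have s0' : s != 0 by rewrite gt_eqF.
set E := expR (s * _) in ep *; set E' := expR (- s * _) in em *.
have muE : mu t = ((s + d) * E * mu t0 + E * z t0
    - E' * z t0 - (- s + d) * E' * mu t0) / (2 * s).
  by apply: (canRL (mulfK _)); [rewrite mulf_neq0 ?pnatr_eq0|lra].
split.
- have -> : z t = E * (z t0 + (s + d) * mu t0) - (s + d) * mu t by lra.
  rewrite muE; have -> : nu^-1 = s ^+ 2 - d ^+ 2 by lra.
  by field.
- by rewrite muE; field.
Qed.

(** * One-sided derivatives at the interface *)

Lemma is_derive_left (R : realType) (g : R -> R) (x l : R) :
  is_derive x 1 g l -> is_left_derive g x l.
Proof.
move=> [dg <-]; apply: cvg_dnbhs_at_left; apply: cvg_trans dg.
apply: near_eq_cvg; apply: nearW => h.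
by rewrite /= [h%:A]mulr1 [h + x]addrC.
Qed.

Lemma is_derive_right (R : realType) (g : R -> R) (x l : R) :
  is_derive x 1 g l -> is_right_derive g x l.
Proof.
move=> [dg <-]; apply: cvg_dnbhs_at_right; apply: cvg_trans dg.
apply: near_eq_cvg; apply: nearW => h.
by rewrite /= [h%:A]mulr1 [h + x]addrC.
Qed.

(** For [lo - hi < h < 0] the difference quotients of [z] and [g] at [hi] coincide, whatever [z]
    does beyond [hi]. *)
Lemma is_left_derive_eq (R : realType) (lo hi l l' : R) (z g : R -> R) :
  lo < hi -> {in `[lo, hi], z =1 g} -> is_derive hi 1 g l' ->
  is_left_derive z hi l -> l = l'.
Proof.
move=> lohi zg /is_derive_left dg dz.
apply: (cvg_unique (@Rhausdorff R) dz); apply: cvg_trans dg.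
apply: near_eq_cvg; near=> h.
have h0 : h < 0 by near: h; exact: nbhs_left_lt.
have hlo : lo - hi < h by near: h; apply: nbhs_left_gt; lra.
by rewrite !zg// in_itv/=; lra.
Unshelve. all: end_near. Qed.

Lemma is_right_derive_eq (R : realType) (lo hi l l' : R) (z g : R -> R) :
  lo < hi -> {in `[lo, hi], z =1 g} -> is_derive lo 1 g l' ->
  is_right_derive z lo l -> l = l'.
Proof.
move=> lohi zg /is_derive_right dg dz.
apply: (cvg_unique (@Rhausdorff R) dz); apply: cvg_trans dg.
apply: near_eq_cvg; near=> h.
have h0 : 0 < h by near: h; exact: nbhs_right_gt.
have hhi : h < hi - lo by near: h; apply: nbhs_right_lt; lra.
by rewrite !zg// in_itv/=; lra.
Unshelve. all: end_near. Qed.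

(** * The Neumann subproblem on the first interval *)

(** Expanding the flow from [alpha] makes [f = nu^-1 * mu alpha - d * z alpha] the coefficient of
    [sinh / sigma]; the condition [z 0 = 0] then determines [z alpha]. *)
Lemma nd2_subproblem1_interface (R : realType) (nu alpha d f : R)
    (z mu : R -> R) : 0 < nu -> 0 < alpha ->
  nd2_subproblem1 nu alpha d f z mu ->
  z alpha = f * tanh (nd2_sigma nu d * alpha) / nd2_sigma nu d.
Proof.
move=> nu0 al0 [sol z00 dz].
have s0 := nd2_sigma_gt0 d nu0; have c0 := cosh_gt0 (nd2_sigma nu d * alpha).
have alin : alpha \in `[0, alpha] by rewrite in_itv/= lexx ltW.
have zE : {in `[0, alpha],
    z =1 fun t => flow_z nu d (z alpha) (mu alpha) (t - alpha)}.
  by move=> t tin; have [] := solves_system_flow nu0 sol alin tin.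
have fE := is_left_derive_eq al0 zE (is_derive_flow_z _ _ _ _ _ nu0) dz.
rewrite subrr flow_mu0 flow_z0 in fE.
have := zE 0; rewrite z00 in_itv/= lexx ltW// => /(_ isT).
rewrite /flow_z -fE sub0r mulrN coshN sinhN /tanh.
set s := nd2_sigma nu d in s0 c0 *; move=> e.
apply: (mulIf (lt0r_neq0 c0)).
have -> : z alpha * cosh (s * alpha) = f / s * sinh (s * alpha) by lra.
by field; rewrite !lt0r_neq0.
Qed.

Lemma nd2_subproblem1_exists (R : realType) (nu alpha d f : R) :
  0 < nu -> 0 < alpha ->
  exists z mu : R -> R, nd2_subproblem1 nu alpha d f z mu.
Proof.
move=> nu0 al0.
have s0 := nd2_sigma_gt0 d nu0; have c0 := cosh_gt0 (nd2_sigma nu d * alpha).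
(* The interface value is the one forced above; [m0] is then solved from the first equation with
   slope [f]. *)
pose z0 := f * tanh (nd2_sigma nu d * alpha) / nd2_sigma nu d.
pose m0 := nu * (f + d * z0).
have dE : nu^-1 * m0 - d * z0 = f.
  by rewrite /m0 mulKf ?lt0r_neq0// addrK.
exists (fun t => flow_z nu d z0 m0 (t - alpha)).
exists (fun t => flow_mu nu d z0 m0 (t - alpha)).
split; first exact: flow_solves_system.
- rewrite /flow_z dE sub0r mulrN coshN sinhN /z0 /tanh.
  by field; rewrite !lt0r_neq0.
- apply: is_derive_left; have := is_derive_flow_z d z0 m0 alpha alpha nu0.
  by rewrite subrr flow_mu0 flow_z0 dE.
Qed.

(** * The Dirichlet subproblem on the second interval *)

(** Since [omega] may be negative, the sum is split as [sigma * (cosh x - sinh x) + (sigma + omega)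
    * sinh x], where [sigma + omega >= sigma + d > 0]. *)
Lemma nd2_denominator_gt0 (R : realType) (nu gamma d x : R) :
  0 < nu -> 0 <= gamma -> 0 <= x ->
  0 < nd2_sigma nu d * cosh x + nd2_omega nu gamma d * sinh x.
Proof.
move=> nu0 g0 x0; have := normr_lt_nd2_sigma d nu0.
rewrite ltr_norml => /andP[ds _].
have os : 0 <= nd2_sigma nu d + nd2_omega nu gamma d.
  have : 0 <= nu^-1 * gamma by rewrite mulr_ge0// invr_ge0 ltW.
  by rewrite /nd2_omega; lra.
have s0 := nd2_sigma_gt0 d nu0.
have cs : 0 < cosh x - sinh x by rewrite subr_gt0 sinh_lt_cosh.
have := mulr_gt0 s0 cs.
have := mulr_ge0 os (sinh_ge0 x0); nra.
Qed.

(* The condition [mu T + gamma z T = 0], written in terms of the Cauchy data at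
   [alpha]. *)
Lemma flow_terminal (R : realType) (nu gamma d z0 m0 t : R) : 0 < nu ->
  nd2_sigma nu d * nu^-1 * (flow_mu nu d z0 m0 t + gamma * flow_z nu d z0 m0 t) =
  (nu^-1 * m0 - d * z0) *
    (nd2_sigma nu d * cosh (nd2_sigma nu d * t) +
     nd2_omega nu gamma d * sinh (nd2_sigma nu d * t)) +
  nd2_sigma nu d * z0 *
    (nd2_sigma nu d * sinh (nd2_sigma nu d * t) +
     nd2_omega nu gamma d * cosh (nd2_sigma nu d * t)).
Proof.
move=> nu0; have s0 := nd2_sigma_gt0 d nu0; have ssq := nd2_sigma_sqr d nu0.
rewrite /flow_z /flow_mu /nd2_omega; set s := nd2_sigma nu d in s0 ssq *.
have -> : nu^-1 = s ^+ 2 - d ^+ 2 by lra.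
by field; rewrite lt0r_neq0.
Qed.

(** Expanding the quotient by [cosh x] gives the form in which the terminal condition yields it. *)
Lemma nd2_dirichlet_to_neumann (R : realType) (nu gamma d x : R) :
  0 < nu -> 0 <= gamma -> 0 <= x ->
  (nd2_sigma nu d * tanh x + nd2_omega nu gamma d) /
    (nd2_sigma nu d + nd2_omega nu gamma d * tanh x) =
  (nd2_sigma nu d * sinh x + nd2_omega nu gamma d * cosh x) /
    (nd2_sigma nu d * cosh x + nd2_omega nu gamma d * sinh x).
Proof.
move=> nu0 g0 x0; have c0 := cosh_gt0 x.
have D0 := nd2_denominator_gt0 d nu0 g0 x0.
by rewrite /tanh; field; rewrite !lt0r_neq0.
Qed.

(** The terminal condition makes the left side of [flow_terminal] vanish; what remains is linear in
    the slope [dz = nu^-1 * mu alpha - d * zal], with a positive coefficient. *)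
Lemma nd2_subproblem2_interface (R : realType) (nu gamma T alpha d zal dz : R)
    (z mu : R -> R) : 0 < nu -> 0 <= gamma -> alpha < T ->
  nd2_subproblem2 nu gamma T alpha d zal z mu -> is_right_derive z alpha dz ->
  let s := nd2_sigma nu d in let w := nd2_omega nu gamma d in
  let b := s * (T - alpha) in
  dz = - (s * zal * ((s * tanh b + w) / (s + w * tanh b))).
Proof.
move=> nu0 g0 alT [sol zE0 bc] hdz s w b.
have s0 := nd2_sigma_gt0 d nu0.
have b0 : 0 <= b by rewrite mulr_ge0 ?ltW// subr_gt0.
have D0 := nd2_denominator_gt0 d nu0 g0 b0.
have alin : alpha \in `[alpha, T] by rewrite in_itv/= lexx ltW.
have Tin : T \in `[alpha, T] by rewrite in_itv/= lexx ltW.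
have zE : {in `[alpha, T],
    z =1 fun t => flow_z nu d (z alpha) (mu alpha) (t - alpha)}.
  by move=> t tin; have [] := solves_system_flow nu0 sol alin tin.
have dE := is_right_derive_eq alT zE (is_derive_flow_z _ _ _ _ _ nu0) hdz.
rewrite subrr flow_mu0 flow_z0 in dE.
have [zT muT] := solves_system_flow nu0 sol alin Tin.
have := flow_terminal gamma d (z alpha) (mu alpha) (T - alpha) nu0.
rewrite -zT -muT bc mulr0 -dE zE0 nd2_dirichlet_to_neumann//.
rewrite -/s -/w -/b in D0 * => e.
apply: (mulIf (lt0r_neq0 D0)).
have -> : dz * (s * cosh b + w * sinh b) =
  - (s * zal * (s * sinh b + w * cosh b)) by lra.
by field; rewrite lt0r_neq0.
Qed.

Lemma nd2_subproblem2_exists (R : realType) (nu gamma T alpha d zal : R) :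
  0 < nu -> 0 <= gamma -> alpha < T ->
  exists (z mu : R -> R) (dz : R),
    nd2_subproblem2 nu gamma T alpha d zal z mu /\ is_right_derive z alpha dz.
Proof.
move=> nu0 g0 alT.
pose s := nd2_sigma nu d; pose w := nd2_omega nu gamma d.
pose b := s * (T - alpha).
have s0 : 0 < s := nd2_sigma_gt0 d nu0.
have b0 : 0 <= b by rewrite mulr_ge0 ?ltW// subr_gt0.
have D0 := nd2_denominator_gt0 d nu0 g0 b0.
(* This slope annihilates the right side of [flow_terminal], and [m0] realises it through the first
   equation. *)
pose dz := - (s * zal * (s * sinh b + w * cosh b)) / (s * cosh b + w * sinh b).
pose m0 := nu * (dz + d * zal).
have dE : nu^-1 * m0 - d * zal = dz.
  by rewrite /m0 mulKf ?lt0r_neq0// addrK.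
exists (fun t => flow_z nu d zal m0 (t - alpha)).
exists (fun t => flow_mu nu d zal m0 (t - alpha)), dz; split; first split.
- exact: flow_solves_system.
- by rewrite subrr flow_z0.
- have c0 : s * nu^-1 != 0 by rewrite mulf_neq0 ?invr_eq0 ?lt0r_neq0.
  apply: (mulfI c0); rewrite mulr0 flow_terminal// dE -/s -/w -/b /dz.
  by field; rewrite lt0r_neq0.
- apply: is_derive_right; have := is_derive_flow_z d zal m0 alpha alpha nu0.
  by rewrite subrr flow_mu0 flow_z0 dE.
Qed.

(** * The scalar iteration and its convergence *)

(** Left to right is uniqueness of the interface values. Right to left is solvability of the
    subproblems, which ensures that iterates exist, so that convergence is not a vacuous
    condition. *)
Lemma nd2_step_factor (R : realType) (nu gamma T alpha theta d f f' : R) :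
  0 < nu -> 0 <= gamma -> 0 < alpha < T ->
  nd2_step nu gamma T alpha theta d f f' <->
  f' = nd2_factor nu gamma T alpha theta d * f.
Proof.
move=> nu0 g0 /andP[al0 alT]; have s0 := nd2_sigma_gt0 d nu0.
have key z1 mu1 z2 mu2 dz2 : nd2_subproblem1 nu alpha d f z1 mu1 ->
    nd2_subproblem2 nu gamma T alpha d (z1 alpha) z2 mu2 ->
    is_right_derive z2 alpha dz2 ->
    (1 - theta) * f + theta * dz2 = nd2_factor nu gamma T alpha theta d * f.
  move=> p1 p2 hdz; rewrite (nd2_subproblem2_interface nu0 g0 alT p2 hdz) /=.
  rewrite (nd2_subproblem1_interface nu0 al0 p1) /nd2_factor /=.
  (* With the quotient abstracted as [q], the only denominator is [sigma], which cancels between the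
     Dirichlet and Neumann values. *)
  by set q := (_ / (_ + _)); field; rewrite lt0r_neq0.
split=> [[z1 [mu1 [z2 [mu2 [dz2 [p1 p2 hdz ->]]]]]]|->].
  exact: key p1 p2 hdz.
have [z1 [mu1 p1]] := nd2_subproblem1_exists d f nu0 al0.
have [z2 [mu2 [dz2 [p2 hdz]]]] :=
  nd2_subproblem2_exists d (z1 alpha) nu0 g0 alT.
by exists z1, mu1, z2, mu2, dz2; split=> //; rewrite (key _ _ _ _ _ p1 p2 hdz).
Qed.

(** If [|x| >= 1], every power has modulus at least 1, so the powers never enter the unit ball
    around 0. *)
Lemma cvg_expr0 (R : realType) (x : R) :
  (x ^+ k @[k --> \oo] --> (0 : R))%classic <-> `|x| < 1.
Proof.
split=> [xk|]; last by move=> /(cvg_geometric 1); rewrite -exprn_geometric.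
rewrite ltNge; apply/negP => x1.
have /cvgr0Pnorm_lt/(_ 1 ltr01)[N _ /(_ N (leqnn N))] := xk.
by rewrite normrX ltNge exprn_ege1.
Qed.

Theorem theorem7 (R : realType) (n : nat) (hn : (0 < n)%N)
    (A : 'M[R]_n) (hA : A^T = A) (d : 'I_n -> R)
    (hd : char_poly A = \prod_(i < n) ('X - (d i)%:P))
    (nu gamma T alpha theta : R)
    (hnu : 0 < nu) (hgamma : 0 <= gamma) (hT : 0 < T)
    (halpha : 0 < alpha < T) (htheta : 0 < theta < 1) :
  nd2_converges nu gamma T alpha theta d <->
  rho_nd2 nu gamma T alpha theta d < 1.
Proof.
pose r i := nd2_factor nu gamma T alpha theta (d i).
split=> [cvg|/bigmax_ltP[_ r1] f0 f [f0E fS] i].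
- apply/bigmax_ltP; split=> [|i _]; first exact: ltr01.
  (* With all initial guesses equal to 1 the iterates are exactly the powers of the factors. *)
  apply/cvg_expr0; apply: (cvg (fun=> 1) (fun k i => r i ^+ k)).
  by split=> // k j; apply/nd2_step_factor => //; rewrite exprS.
- have fE k : f k i = r i ^+ k * f0 i.
    elim: k => [|k IH]; first by rewrite mul1r f0E.
    have /nd2_step_factor-> // := fS k i.
    by rewrite IH exprS mulrA.
  under eq_fun do rewrite fE.
  rewrite -(mul0r (f0 i)); by apply: cvgM (cvg_cst _); exact/cvg_expr0/r1.
Qed.
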